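(* (Compactness Theorem) Let $\tau$ be a first-order language. A $\tau$-theory $T$ of the first-order additive Gödel logic AG$\forall$ is satisfiable if and only if it is finitely satisfiable.
   Context: Syntax of AG$\forall$. A first-order language $\tau$ is a set of function symbols and predicate symbols, each with an arity $\ge 0$ (nullary function symbols are constant symbols; nullary predicate symbols are allowed). Terms are as in classical first-order logic. Formulas are built, using countably many variables, from atomic formulas $P(t_1,\dots,t_n)$ and the logical constants $\bot,\bar 1$ with the connectives $\wedge,\to,\otimes$ (binary), $^{-1}$ (unary) and the quantifiers $\forall,\exists$. There is no built-in equality symbol. A sentence is a formula without free variables; a theory is a set of sentences. Truth values. For a totally ordered Abelian group $(G,*,1_G,\le)$ written multiplicatively, $\Gamma_G=G\cup\{0,\infty\}$, where $0$ and $\infty$ are two new elements, the least and largest elements of $\Gamma_G$. The operations are extended by $0*\infty=\infty*0=1_G$; $a*\infty=\infty*a=\infty$ and $a*0=0*a=0$ for $a\in G$; $\infty*\infty=\infty$, $0*0=0$; $0^{-1}=\infty$, $\infty^{-1}=0$. Structures. A $\tau$-structure $\mathcal M=(G,M)$ consists of a nonempty set $M$, a totally ordered Abelian group $G$, a function $P^{\mathcal M}:M^n\to\Gamma_G$ for each $n$-ary predicate symbol (an element of $\Gamma_G$ if $n=0$), and a function $f^{\mathcal M}:M^n\to M$ for each $n$-ary function symbol (an element of $M$ if $n=0$). Terms are interpreted as usual. Formulas are interpreted as functions into $\Gamma_G$ by: $\bot^{\mathcal M}=0$, $\bar 1^{\mathcal M}=1_G$; atomic formulas via $P^{\mathcal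 M}$; $\wedge$ as minimum; $\varphi\to\psi$ has value $\infty$ if the value $a$ of $\varphi$ is $\le$ the value $b$ of $\psi$, and value $b$ otherwise; $\otimes$ as $*$; $^{-1}$ as inverse in $\Gamma_G$; $\forall y$ and $\exists y$ as infimum and supremum in $\Gamma_G$ over $M$. All structures are assumed safe: all infima and suprema needed to interpret formulas exist. Satisfiability. For a sentence $\varphi$, $\mathcal M\models\varphi$ means $\varphi^{\mathcal M}=\infty$; $\mathcal M$ is a model of $T$ if $\mathcal M\models\varphi$ for all $\varphi\in T$. $T$ is satisfiable if it has a model (over some totally ordered Abelian group $G$), and finitely satisfiable if every finite subset of $T$ has a model (the group may depend on the finite subset). *)

(* Defs.v *)
From HB Require Import structures.
From mathcomp Require Import all_boot all_order.
From mathcomp Require Import boolp classical_sets cardinality.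

Set Implicit Arguments.
Unset Strict Implicit.
Unset Printing Implicit Defensive.

Import Order.TTheory.
Local Open Scope order_scope.
Local Open Scope classical_set_scope.

Fact oag_display : Order.disp_t. Proof. exact: Order.Disp tt tt. Qed.

HB.mixin Record Group_isOrderedAbelian G
    of Group G & Order.Total oag_display G := {
  oag_mulgC : commutative (fun x y : G => x * y)%g;
  oag_leM2r : forall z x y : G, x <= y -> (x * z)%g <= (y * z)%g
}.

(* The trivial group is not excluded.  The base types carry a choiceType
   structure, which classically every type has. *)
#[short(type="oagType")]
HB.structure Definition OrderedAbelianGroup :=
  {G of Group G & Order.Total oag_display G & Group_isOrderedAbelian G}.

Inductive gamma (G : Type) : Type := Zero | Fin (a : G) | Infty.
Arguments Zero {G}.
Arguments Infty {G}.

Definition option_of_gamma G (u : gamma G) : option (option G) :=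
  match u with Zero => None | Fin a => Some (Some a) | Infty => Some None end.

Definition gamma_of_option G (o : option (option G)) : gamma G :=
  match o with None => Zero | Some (Some a) => Fin a | Some None => Infty end.

Lemma option_of_gammaK G : cancel (@option_of_gamma G) (@gamma_of_option G).
Proof. by case. Qed.

HB.instance Definition _ (G : choiceType) :=
  Choice.copy (gamma G) (can_type (@option_of_gammaK G)).

Section Gamma.
Variable G : oagType.
Implicit Types u v : gamma G.

Definition gamma_le u v : bool :=
  match u, v with
  | Zero, _ | _, Infty => true
  | Fin a, Fin b => a <= b
  | _, _ => false
  end.

Lemma gamma_le_refl : reflexive gamma_le.
Proof. by case=> [|a|] /=. Qed.

Lemma gamma_le_anti : antisymmetric gamma_le.
Proof. by case=> [|a|] [|b|] //= /le_anti ->. Qed.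

Lemma gamma_le_trans : transitive gamma_le.
Proof. by case=> [|b|] [|a|] [|c|] //=; apply: le_trans. Qed.

Lemma gamma_le_total : total gamma_le.
Proof. by case=> [|a|] [|b|] //=; apply: le_total. Qed.

HB.instance Definition _ := Order.Le_isPOrder.Build oag_display (gamma G)
  gamma_le_refl gamma_le_anti gamma_le_trans.
HB.instance Definition _ :=
  Order.POrder_isTotal.Build oag_display (gamma G) gamma_le_total.

Lemma gamma_le0 u : Zero <= u. Proof. by case: u. Qed.
Lemma gamma_ley u : u <= Infty. Proof. by case: u. Qed.

HB.instance Definition _ :=
  Order.hasBottom.Build oag_display (gamma G) gamma_le0.
HB.instance Definition _ :=
  Order.hasTop.Build oag_display (gamma G) gamma_ley.

Definition gamma_mul u v : gamma G :=
  match u, v with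
  | Zero, Infty | Infty, Zero => Fin 1%g
  | Zero, _ | _, Zero => Zero
  | Infty, _ | _, Infty => Infty
  | Fin a, Fin b => Fin (a * b)%g
  end.

Definition gamma_inv u : gamma G :=
  match u with Zero => Infty | Fin a => Fin a^-1%g | Infty => Zero end.

Definition gamma_imp u v : gamma G := if u <= v then Infty else v.

End Gamma.

Record language := Language {
  fun_sym : Type;
  fun_arity : fun_sym -> nat;
  pred_sym : Type;
  pred_arity : pred_sym -> nat
}.

Inductive term (L : language) : Type :=
| Var (x : nat)
| App (f : fun_sym L) (args : {ffun 'I_(fun_arity f) -> term L}).
Arguments Var {L} x.

Inductive formula (L : language) : Type :=
| Atom (P : pred_sym L) (args : {ffun 'I_(pred_arity P) -> term L})
| Bot
| One
| And (p q : formula L)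
| Imp (p q : formula L)
| Tensor (p q : formula L)
| Inv (p : formula L)
| All (y : nat) (p : formula L)
| Ex (y : nat) (p : formula L).
Arguments Bot {L}.
Arguments One {L}.

Fixpoint occurs L (x : nat) (t : term L) : Prop :=
  match t with
  | Var y => x = y
  | App f args => exists i, occurs x (args i)
  end.

Fixpoint free_in L (x : nat) (p : formula L) : Prop :=
  match p with
  | Atom P args => exists i, occurs x (args i)
  | Bot | One => False
  | And p q | Imp p q | Tensor p q => free_in x p \/ free_in x q
  | Inv p => free_in x p
  | All y p | Ex y p => x <> y /\ free_in x p
  end.

Definition sentence L (p : formula L) : Prop := forall x, ~ free_in x p.

Definition theory L (T : set (formula L)) : Prop := forall p, T p -> sentence p.

Record prestructure (L : language) := PreStructure {
  value_group : oagType;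
  carrier :> Type;
  carrier_inhabited : inhabited carrier;
  fun_interp :
    forall f : fun_sym L, {ffun 'I_(fun_arity f) -> carrier} -> carrier;
  pred_interp :
    forall P : pred_sym L,
      {ffun 'I_(pred_arity P) -> carrier} -> gamma value_group
}.

Section Semantics.
Variables (L : language) (M : prestructure L).
Implicit Types (e : nat -> M) (p q : formula L).

Fixpoint term_value e (t : term L) : M :=
  match t with
  | Var x => e x
  | App f args => fun_interp [ffun i => term_value e (args i)]
  end.

(* [infimum] and [supremum] return their first argument when the bound does
   not exist; [safe] below makes that case irrelevant. *)
Fixpoint value e p : gamma (value_group M) :=
  match p with
  | Atom P args => pred_interp [ffun i => term_value e (args i)]
  | Bot => Zero
  | One => Fin 1%g
  | And p q => Order.min (value e p) (value e q)
  | Imp p q => gamma_imp (value e p) (value e q)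
  | Tensor p q => gamma_mul (value e p) (value e q)
  | Inv p => gamma_inv (value e p)
  | All y p => infimum Infty (range (fun m => value [eta e with y |-> m] p))
  | Ex y p => supremum Zero (range (fun m => value [eta e with y |-> m] p))
  end.

Definition safe : Prop := forall e y p,
  infimums (range (fun m => value [eta e with y |-> m] p)) !=set0 /\
  supremums (range (fun m => value [eta e with y |-> m] p)) !=set0.

(* The value of a sentence does not depend on [e]. *)
Definition satisfies p : Prop := forall e, value e p = Infty.

End Semantics.

Record structure (L : language) := Structure {
  prestructure_of :> prestructure L;
  structure_safe : safe prestructure_of
}.

Definition model L (M : structure L) (T : set (formula L)) : Prop :=
  forall p, T p -> satisfies M p.

Definition satisfiable L (T : set (formula L)) : Prop :=
  exists M : structure L, model M T.

Definition finitely_satisfiable L (T : set (formula L)) : Prop :=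
  forall S : set (formula L), finite_set S -> S `<=` T -> satisfiable S.

(* Main.v *)
(* A model of [T] is an ultraproduct of models of the finite subsets of [T].
   Infima and suprema are preserved, although they may be infinite: if an
   element [u] lies strictly above the fibrewise infimum, then almost every
   fibre contains a witness with value below [u], and the witnesses assemble
   into a single element of the ultraproduct.  Hence the ultraproduct is safe
   and Los's theorem holds for the exact truth values. *)
Require Import Defs.
From HB Require Import structures.
From mathcomp Require Import all_boot all_order generic_quotient.
From mathcomp Require Import boolp classical_sets cardinality filter.

Set Implicit Arguments.
Unset Strict Implicit.
Unset Printing Implicit Defensive.

Import Order.TTheory.
Local Open Scope order_scope.
Local Open Scope classical_set_scope.
Local Open Scope quotient_scope.

(** * Ultrafilters and the propositional connectives *)

Section Ultrafilter.
Variables (I : Type) (U : set_system I) (FU : UltraFilter U).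
Implicit Types P Q : I -> Prop.

Lemma ultra_iff P Q : U (fun i => P i <-> Q i) -> U P <-> U Q.
Proof. by move=> PQ; split; apply: filterS2 PQ => i []; auto. Qed.

Lemma ultra_not P : U (fun i => ~ P i) <-> ~ U P.
Proof.
split=> [nP UP|nP]; last by case: (in_ultra_setVsetC P FU).
by apply: (filter_not_empty U); apply: filterS2 nP UP.
Qed.

Lemma ultra_or P Q : U (fun i => P i \/ Q i) -> U P \/ U Q.
Proof.
move=> PQ; have [|/ultra_not nP] := pselect (U P); [by left|right].
by apply: filterS2 PQ nP => i [].
Qed.

End Ultrafilter.

(** * The ultraproduct of totally ordered Abelian groups *)

Section UltraproductGroup.
Variables (I : Type) (U : set_system I) (FU : UltraFilter U).
Variable G : I -> oagType.

Definition ultra_eq (f g : forall i, G i) : bool := `[< U (fun i => f i = g i) >].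

Lemma ultra_eq_refl : reflexive ultra_eq.
Proof. by move=> f; apply/asboolP; apply: filterE. Qed.

Lemma ultra_eq_sym : symmetric ultra_eq.
Proof.
by move=> f g; apply/asboolP/asboolP; apply: filterS => i ->.
Qed.

Lemma ultra_eq_trans : transitive ultra_eq.
Proof.
move=> g f h /asboolP fg /asboolP gh; apply/asboolP.
by apply: filterS2 fg gh => i -> ->.
Qed.

Canonical ultra_equiv :=
  EquivRel ultra_eq ultra_eq_refl ultra_eq_sym ultra_eq_trans.

Definition ultra_group := {eq_quot ultra_equiv}.
HB.instance Definition _ := Choice.on ultra_group.

Definition ultra_class (f : forall i, G i) : ultra_group := \pi_ultra_group f.

Lemma ultra_classP f g : ultra_class f = ultra_class g <-> U (fun i => f i = g i).
Proof. by split=> [/eqmodP/asboolP|fg]; last exact/eqmodP/asboolP. Qed.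

Lemma ultra_class_repr (a : ultra_group) : ultra_class (repr a) = a.
Proof. exact: reprK. Qed.

Lemma repr_ultra_class f : U (fun i => repr (ultra_class f) i = f i).
Proof. by apply/ultra_classP; rewrite ultra_class_repr. Qed.

Lemma ultra_classW (P : ultra_group -> Prop) :
  (forall f, P (ultra_class f)) -> forall a, P a.
Proof. by move=> Pf a; rewrite -(ultra_class_repr a). Qed.

(** The operations and the order are computed on chosen representatives [repr]; [ultra_mulE],
    [ultra_invE] and [ultra_leP] show that any other representatives give the same result. *)
Definition ultra_mul (a b : ultra_group) :=
  ultra_class (fun i => repr a i * repr b i)%g.
Definition ultra_inv (a : ultra_group) :=
  ultra_class (fun i => (repr a i)^-1)%g.
Definition ultra_one := ultra_class (fun=> 1)%g.
Definition ultra_le (a b : ultra_group) : bool :=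
  `[< U (fun i => repr a i <= repr b i) >].

Lemma ultra_mulE f g :
  ultra_mul (ultra_class f) (ultra_class g) = ultra_class (fun i => f i * g i)%g.
Proof.
apply/ultra_classP.
by apply: filterS2 (repr_ultra_class f) (repr_ultra_class g) => i -> ->.
Qed.

Lemma ultra_invE f :
  ultra_inv (ultra_class f) = ultra_class (fun i => (f i)^-1)%g.
Proof.
by apply/ultra_classP; apply: filterS (repr_ultra_class f) => i ->.
Qed.

Lemma ultra_leP f g :
  ultra_le (ultra_class f) (ultra_class g) <-> U (fun i => f i <= g i).
Proof.
apply: iff_trans (iff_sym (rwP (asboolP _))) _; apply: ultra_iff.
by apply: filterS2 (repr_ultra_class f) (repr_ultra_class g) => i -> ->.
Qed.

Lemma ultra_mulA : associative ultra_mul.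
Proof.
elim/ultra_classW=> f; elim/ultra_classW=> g; elim/ultra_classW=> h.
by rewrite !ultra_mulE; apply/ultra_classP; apply: filterE => i; apply: mulgA.
Qed.

Lemma ultra_mulC : commutative ultra_mul.
Proof.
elim/ultra_classW=> f; elim/ultra_classW=> g.
by rewrite !ultra_mulE; apply/ultra_classP; apply: filterE => i; apply: oag_mulgC.
Qed.

Lemma ultra_mul1 : left_id ultra_one ultra_mul.
Proof.
elim/ultra_classW=> f.
by rewrite ultra_mulE; apply/ultra_classP; apply: filterE => i; apply: mul1g.
Qed.

Lemma ultra_mulV : left_inverse ultra_one ultra_inv ultra_mul.
Proof.
elim/ultra_classW=> f; rewrite ultra_invE ultra_mulE.
by apply/ultra_classP; apply: filterE => i; apply: mulVg.
Qed.

HB.instance Definition _ := isGroup.Build ultra_group ultra_mulA ultra_mul1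
  (fun a => etrans (ultra_mulC a _) (ultra_mul1 a)) ultra_mulV
  (fun a => etrans (ultra_mulC a _) (ultra_mulV a)).

Lemma ultra_le_refl : reflexive ultra_le.
Proof. by elim/ultra_classW=> f; apply/ultra_leP; apply: filterE. Qed.

Lemma ultra_le_anti : antisymmetric ultra_le.
Proof.
elim/ultra_classW=> f; elim/ultra_classW=> g /andP[/ultra_leP fg /ultra_leP gf].
by apply/ultra_classP; apply: filterS2 fg gf => i ? ?; apply/le_anti/andP.
Qed.

Lemma ultra_le_trans : transitive ultra_le.
Proof.
elim/ultra_classW=> g; elim/ultra_classW=> f; elim/ultra_classW=> h.
move=> /ultra_leP fg /ultra_leP gh; apply/ultra_leP.
by apply: filterS2 fg gh => i; apply: le_trans.
Qed.

Lemma ultra_le_total : total ultra_le.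
Proof.
elim/ultra_classW=> f; elim/ultra_classW=> g; apply/orP.
have: U (fun i => f i <= g i \/ g i <= f i).
  by apply: filterE => i; apply/orP; apply: le_total.
by case/ultra_or=> [fg|gf]; [left|right]; apply/ultra_leP.
Qed.

HB.instance Definition _ := Order.Le_isPOrder.Build oag_display ultra_group
  ultra_le_refl ultra_le_anti ultra_le_trans.
HB.instance Definition _ :=
  Order.POrder_isTotal.Build oag_display ultra_group ultra_le_total.

Lemma ultra_leM2r (c a b : ultra_group) : a <= b -> (a * c)%g <= (b * c)%g.
Proof.
elim/ultra_classW: c => h; elim/ultra_classW: a => f; elim/ultra_classW: b => g.
move=> /ultra_leP fg.
(* Unfolds the group and order structures, so that [ultra_mulE] and [ultra_leP] apply. *)
change (is_true (ultra_le (ultra_mul (ultra_class f) (ultra_class h))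
  (ultra_mul (ultra_class g) (ultra_class h)))).
rewrite !ultra_mulE; apply/ultra_leP; apply: filterS fg => i.
exact: oag_leM2r.
Qed.

HB.instance Definition _ :=
  Group_isOrderedAbelian.Build ultra_group ultra_mulC ultra_leM2r.

End UltraproductGroup.

(** * Limits of truth values along the ultrafilter *)

Section UltraLimit.
Variables (I : Type) (U : set_system I) (FU : UltraFilter U).
Variable G : I -> oagType.
Implicit Types x y : forall i, gamma (G i).

Let UG : oagType := ultra_group FU G.

(** This identifies the ultraproduct of the sets [gamma (G i)] with [gamma] of the ultraproduct
    group: almost all [x i] have the same one of the three shapes. In the last branch almost all
    [x i] are finite, so the default [1] affects only a negligible set of indices. *)
Definition ulim x : gamma UG :=
  if `[< U (fun i => x i = Zero) >] then Zero
  else if `[< U (fun i => x i = Infty) >] then Infty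
  else Fin (ultra_class FU (fun i => if x i is Fin a then a else 1%g)).

Lemma ulim_Zero x : U (fun i => x i = Zero) -> ulim x = Zero.
Proof. by move=> x0; rewrite /ulim asboolT. Qed.

Lemma ulim_Infty x : U (fun i => x i = Infty) -> ulim x = Infty.
Proof.
move=> xy; rewrite /ulim asboolF ?asboolT//.
by apply/ultra_not; apply: filterS xy => i ->.
Qed.

Lemma ulim_Fin x f :
  U (fun i => x i = Fin (f i)) -> ulim x = Fin (ultra_class FU f).
Proof.
move=> xf; rewrite /ulim.
rewrite !asboolF; try by apply/ultra_not; apply: filterS xf => i ->.
by congr Fin; apply/ultra_classP; apply: filterS xf => i ->.
Qed.

Variant ulim_spec x : gamma UG -> Prop :=
| UlimZero of U (fun i => x i = Zero) : ulim_spec x Zero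
| UlimFin f of U (fun i => x i = Fin (f i)) : ulim_spec x (Fin (ultra_class FU f))
| UlimInfty of U (fun i => x i = Infty) : ulim_spec x Infty.

Lemma ulimP x : ulim_spec x (ulim x).
Proof.
have [x0|/(ultra_not FU) x0] := pselect (U (fun i => x i = Zero)).
  by rewrite ulim_Zero//; constructor.
have [xy|/(ultra_not FU) xy] := pselect (U (fun i => x i = Infty)).
  by rewrite ulim_Infty//; constructor.
have xf : U (fun i => x i = Fin (if x i is Fin a then a else 1%g)).
  by apply: filterS2 x0 xy => i; case: (x i).
by rewrite (ulim_Fin xf); constructor.
Qed.

Lemma ulim_eq x y : U (fun i => x i = y i) -> ulim x = ulim y.
Proof.
move=> xy; case: (ulimP y) => [y0|f yf|yy].
- by apply: ulim_Zero; apply: filterS2 xy y0 => i ->.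
- by apply: ulim_Fin; apply: filterS2 xy yf => i ->.
- by apply: ulim_Infty; apply: filterS2 xy yy => i ->.
Qed.

(** Lets an arbitrary competing bound in [gamma UG] be compared fibre by fibre. *)
Lemma ulim_surj (u : gamma UG) : exists x, u = ulim x.
Proof.
case: u => [|a|].
- by exists (fun=> Zero); rewrite ulim_Zero//; apply: filterE.
- exists (fun i => Fin (repr a i)); rewrite (ulim_Fin (f := repr a)).
    by rewrite ultra_class_repr.
  exact: filterE.
- by exists (fun=> Infty); rewrite ulim_Infty//; apply: filterE.
Qed.

Lemma ulim_le x y : ulim x <= ulim y <-> U (fun i => x i <= y i).
Proof.
have U0 := filter_not_empty U.
case: (ulimP x) => [x0|f xf|x8].
- by split=> // _; apply: filterS x0 => i ->.
- case: (ulimP y) => [y0|g yg|y8].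
  + by split=> // xy; case: U0; apply: filterS3 xf y0 xy => i -> ->.
  + apply: iff_trans (ultra_leP FU f g) _; apply: ultra_iff.
    by apply: filterS2 xf yg => i -> ->.
  + by split=> // _; apply: filterS y8 => i ->; case: (x i).
- case: (ulimP y) => [y0|g yg|y8].
  + by split=> // xy; case: U0; apply: filterS3 x8 y0 xy => i -> ->.
  + by split=> // xy; case: U0; apply: filterS3 x8 yg xy => i -> ->.
  + by split=> // _; apply: filterS y8 => i ->; case: (x i).
Qed.

(** Both orders are total, so this is the negation of [ulim_le], and an ultrafilter commutes with
    negation. *)
Lemma ulim_lt x y : ulim x < ulim y <-> U (fun i => x i < y i).
Proof.
split=> [|xy].
  rewrite ltNge => /negP yx.
  have /(ultra_not FU) : ~ U (fun i => y i <= x i) by move/ulim_le.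
  by apply: filterS => i /negP; rewrite -ltNge.
rewrite ltNge; apply/negP => /ulim_le; apply/(ultra_not FU).
by apply: filterS xy => i; rewrite ltNge => /negP.
Qed.

Lemma ulim_min x y :
  ulim (fun i => Order.min (x i) (y i)) = Order.min (ulim x) (ulim y).
Proof.
have [xy|yx] := leP (ulim x) (ulim y).
  by apply: ulim_eq; move/ulim_le: xy; apply: filterS => i /min_idPl.
by apply: ulim_eq; move/ulim_lt: yx; apply: filterS => i /ltW /min_idPr.
Qed.

(** Although the Gödel implication is discontinuous, its value depends only on the consequent and on
    whether [x <= y], which the ultrafilter decides. *)
Lemma ulim_imp x y :
  ulim (fun i => gamma_imp (x i) (y i)) = gamma_imp (ulim x) (ulim y).
Proof.
rewrite /gamma_imp; have [xy|yx] := leP (ulim x) (ulim y).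
  by apply: ulim_Infty; move/ulim_le: xy; apply: filterS => i ->.
apply: ulim_eq; move/ulim_lt: yx; apply: filterS => i.
by rewrite ltNge => /negPf->.
Qed.

Lemma ulim_inv x : ulim (fun i => gamma_inv (x i)) = gamma_inv (ulim x).
Proof.
case: (ulimP x) => [x0|f xf|x8].
- by apply: ulim_Infty; apply: filterS x0 => i ->.
- rewrite /= (ulim_Fin (f := fun i => (f i)^-1%g)).
    by rewrite -ultra_invE.
  by apply: filterS xf => i ->.
- by apply: ulim_Zero; apply: filterS x8 => i ->.
Qed.

Lemma ulim_mul x y :
  ulim (fun i => gamma_mul (x i) (y i)) = gamma_mul (ulim x) (ulim y).
Proof.
case: (ulimP x) => [x0|f xf|x8]; case: (ulimP y) => [y0|g yg|y8] /=;
  do ?[by apply: ulim_Zero; apply: filterS2 x0 y0 => i -> ->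
      |by apply: ulim_Zero; apply: filterS2 x0 yg => i -> ->
      |by apply: ulim_Zero; apply: filterS2 xf y0 => i -> ->
      |by apply: ulim_Infty; apply: filterS2 x8 y8 => i -> ->
      |by apply: ulim_Infty; apply: filterS2 x8 yg => i -> ->
      |by apply: ulim_Infty; apply: filterS2 xf y8 => i -> ->
      |by apply: ulim_Fin; apply: filterS2 x0 y8 => i -> ->
      |by apply: ulim_Fin; apply: filterS2 x8 y0 => i -> ->].
(* Of the nine pairs of shapes, only the one with two finite values is left. *)
rewrite -[(_ * _)%g]/(ultra_mul _ _) ultra_mulE.
by apply: ulim_Fin; apply: filterS2 xf yg => i -> ->.
Qed.

(** * Infima and suprema of limits *)

Section Bounds.
Variables (M : I -> Type) (v : forall i, M i -> gamma (G i)).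
Hypothesis M_inh : forall i, inhabited (M i).

Lemma ultra_choice (P : forall i, M i -> Prop) :
  U (fun i => exists m, P i m) ->
  exists m : forall i, M i, U (fun i => P i (m i)).
Proof.
move=> exP.
(* An arbitrary element fills the fibres without a witness, so that the choice is total. *)
have /(_ _)/cid-/all_tag[m mP] i : exists m, (exists m', P i m') -> P i m.
  have [[m Pm]|nP] := pselect (exists m, P i m); first by exists m.
  by have [m] := M_inh i; exists m.
by exists m; apply: filterS exP => i; apply: mP.
Qed.

Lemma ulim_infimum b : (forall i, infimums (range (@v i)) (b i)) ->
  infimums (range (fun m : forall i, M i => ulim (fun i => v (m i)))) (ulim b).
Proof.
move=> bP; split.
  move=> _ [m _ <-]; apply/ulim_le; apply: filterE => i.
  by case: (bP i) => lb _; apply: lb; exists (m i).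
move=> u; have [x ->{u}] := ulim_surj u => xlb.
rewrite leNgt; apply/negP => /ulim_lt bx.
(* Where [b i < x i], the value [x i] is not a lower bound of its fibre. The assembled witnesses
   then contradict that [ulim x] is a lower bound. *)
have [|m vm] := ultra_choice (P := fun i m => v m < x i).
  apply: filterS bx => i; apply: contraPP => nex; apply/negP; rewrite -leNgt.
  case: (bP i) => _; apply=> _ [m _ <-]; rewrite leNgt; apply/negP => vm.
  by apply: nex; exists m.
have /ulim_lt := vm; rewrite ltNge => /negP; apply.
by apply: xlb; exists m.
Qed.

Lemma ulim_supremum b : (forall i, supremums (range (@v i)) (b i)) ->
  supremums (range (fun m : forall i, M i => ulim (fun i => v (m i)))) (ulim b).
Proof.
move=> bP; split.
  move=> _ [m _ <-]; apply/ulim_le; apply: filterE => i.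
  by case: (bP i) => ub _; apply: ub; exists (m i).
move=> u; have [x ->{u}] := ulim_surj u => xub.
rewrite leNgt; apply/negP => /ulim_lt xb.
have [|m vm] := ultra_choice (P := fun i m => x i < v m).
  apply: filterS xb => i; apply: contraPP => nex; apply/negP; rewrite -leNgt.
  case: (bP i) => _; apply=> _ [m _ <-]; rewrite leNgt; apply/negP => vm.
  by apply: nex; exists m.
have /ulim_lt := vm; rewrite ltNge => /negP; apply.
by apply: xub; exists m.
Qed.

End Bounds.
End UltraLimit.

(** * Induction on terms and uniqueness of bounds *)

Lemma term_ffun_ind L (P : term L -> Prop) :
  (forall x, P (Var x)) ->
  (forall f (args : {ffun 'I_(fun_arity f) -> term L}),
    (forall j, P (args j)) -> P (App args)) ->
  forall t, P t.
Proof.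
(* The arguments of [App] sit inside a finite function; a direct [fix] provides the induction
   hypothesis for each [args j]. *)
move=> PV PA; fix IH 1 => -[x|f args]; first exact: PV.
by apply: PA => j; apply: IH.
Qed.

(** [infimum] selects some greatest lower bound, and antisymmetry leaves only one. Nonemptiness and
    existence exclude the default [x0]. *)
Lemma infimumE d (T : porderType d) (x0 b : T) (A : set T) :
  A !=set0 -> infimums A b -> infimum x0 A = b.
Proof.
move=> /set0P A0 Ab; rewrite /infimum (negPf A0).
by apply: is_subset1_infimums; first apply: xgetPex; first by exists b.
Qed.

Lemma supremumE d (T : porderType d) (x0 b : T) (A : set T) :
  A !=set0 -> supremums A b -> supremum x0 A = b.
Proof.
move=> /set0P A0 Ab; rewrite /supremum (negPf A0).
by apply: is_subset1_supremums; first apply: xgetPex; first by exists b.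
Qed.

(** * The ultraproduct structure and Łoś's theorem *)

Section Ultraproduct.
Variables (L : language) (I : Type) (U : set_system I) (FU : UltraFilter U).
Variable M : I -> structure L.

Lemma range_inh (N : prestructure L) T (F : N -> T) : range F !=set0.
Proof. by have [m] := carrier_inhabited N; exists (F m), m. Qed.

(** Safety of the fibre guarantees a genuine infimum instead of the default value. *)
Lemma value_All i e y p :
  infimums (range (fun m => value [eta e with y |-> m] p))
    (value (M := M i) e (All y p)).
Proof.
have [[b bP] _] := @structure_safe _ (M i) e y p.
by rewrite /= (infimumE _ _ bP)//; apply: range_inh.
Qed.

Lemma value_Ex i e y p :
  supremums (range (fun m => value [eta e with y |-> m] p))
    (value (M := M i) e (Ex y p)).
Proof.
have [_ [b bP]] := @structure_safe _ (M i) e y p.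
by rewrite /= (supremumE _ _ bP)//; apply: range_inh.
Qed.

Lemma ultra_inhabited : inhabited (forall i, M i).
Proof.
have /(_ _)/cid-/all_tag[m _] i : exists m : M i, True.
  by have [m] := carrier_inhabited (M i); exists m.
exact: (inhabits m).
Qed.

(* The language has no equality, so only the value group is quotiented by the
   ultrafilter; the carrier remains the full product. *)
Definition ultraprestructure : prestructure L := {|
  value_group := ultra_group FU (fun i => value_group (M i));
  carrier := forall i, M i;
  carrier_inhabited := ultra_inhabited;
  fun_interp := fun f args i => fun_interp [ffun j => args j i];
  pred_interp := fun P args =>
    ulim FU (fun i => pred_interp (p := M i) [ffun j => args j i])
|}.

Local Notation N := ultraprestructure.

Lemma term_value_ultra (e : nat -> N) t i :
  term_value e t i = term_value (M := M i) (fun x => e x i) t.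
Proof.
elim/term_ffun_ind: t => //= f args IH; congr fun_interp.
by apply/ffunP => j; rewrite !ffunE IH.
Qed.

Lemma update_ultra (e : nat -> N) y (m : N) i :
  (fun x => [eta e with y |-> m] x i) = [eta (fun x => e x i) with y |-> m i].
Proof. by apply: functional_extensionality_dep => x /=; case: ifP. Qed.

Section Quantifiers.
Variable p : formula L.
(** This is the induction hypothesis of [value_ultra]. Isolating it lets the lemmas below serve both
    the quantifier cases of that induction and, afterwards, the proof of safety. *)
Hypothesis value_p : forall e : nat -> N,
  value e p = ulim FU (fun i => value (M := M i) (fun x => e x i) p).

Lemma value_ultra_update (e : nat -> N) y :
  (fun m : N => value [eta e with y |-> m] p) =
  (fun m : N => ulim FU
    (fun i => value (M := M i) [eta (fun x => e x i) with y |-> m i] p)).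
Proof.
apply: functional_extensionality_dep => m; rewrite value_p.
by congr ulim; apply: functional_extensionality_dep => i; rewrite update_ultra.
Qed.

Lemma infimums_ultra (e : nat -> N) y :
  infimums (range (fun m : N => value [eta e with y |-> m] p))
    (ulim FU (fun i => value (M := M i) (fun x => e x i) (All y p))).
Proof.
rewrite value_ultra_update.
apply: (@ulim_infimum _ _ FU _ (fun i => M i) (fun i m =>
  value [eta (fun x => e x i) with y |-> m] p)) => i; last exact: value_All.
exact: carrier_inhabited.
Qed.

Lemma supremums_ultra (e : nat -> N) y :
  supremums (range (fun m : N => value [eta e with y |-> m] p))
    (ulim FU (fun i => value (M := M i) (fun x => e x i) (Ex y p))).
Proof.
rewrite value_ultra_update.
apply: (@ulim_supremum _ _ FU _ (fun i => M i) (fun i m =>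
  value [eta (fun x => e x i) with y |-> m] p)) => i; last exact: value_Ex.
exact: carrier_inhabited.
Qed.

End Quantifiers.

(** Łoś's theorem for truth values, by induction on [p] for all [e], since quantifiers update [e].
    Safety of [N] is not presupposed: the limit of the fibre values is itself shown to be the
    required bound. *)
Theorem value_ultra p (e : nat -> N) :
  value e p = ulim FU (fun i => value (M := M i) (fun x => e x i) p).
Proof.
elim: p e =>
  [P args|||p IHp q IHq|p IHp q IHq|p IHp q IHq|p IHp|y p IHp|y p IHp] e.
- rewrite /=; congr ulim; apply: functional_extensionality_dep => i.
  by congr pred_interp; apply/ffunP => j; rewrite !ffunE term_value_ultra.
- by rewrite ulim_Zero//; apply: filterE.
- by rewrite (@ulim_Fin _ _ FU _ _ (fun=> 1%g))//; apply: filterE.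
- by rewrite /= IHp IHq ulim_min.
- by rewrite /= IHp IHq ulim_imp.
- by rewrite /= IHp IHq ulim_mul.
- by rewrite /= IHp ulim_inv.
- apply: infimumE; last exact: infimums_ultra.
  exact: (range_inh (N := N)).
- apply: supremumE; last exact: supremums_ultra.
  exact: (range_inh (N := N)).
Qed.

Lemma ultra_safe : safe N.
Proof.
move=> e y p; split; eexists.
- by apply: infimums_ultra => e0; apply: value_ultra.
- by apply: supremums_ultra => e0; apply: value_ultra.
Qed.

Definition ultraproduct : structure L := Structure ultra_safe.

Lemma satisfies_ultraproduct p :
  U (fun i => satisfies (M i) p) -> satisfies ultraproduct p.
Proof.
move=> Up e; rewrite /= value_ultra; apply: ulim_Infty.
by apply: filterS Up => i; apply.
Qed.

End Ultraproduct.

(** * The filter on finite subsets, and compactness *)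

Section FiniteParts.
Variables (X : Type) (T : set X).

Definition finite_subset (S : set X) := finite_set S /\ S `<=` T.

Definition finite_part := {S : set X | finite_subset S}.

(** Generated by the cones of all finite subsets of [T] that extend a given one. *)
Definition finite_parts_filter : set_system finite_part :=
  filter_from setT (fun S : finite_part => [set S' | sval S `<=` sval S']).

(** Each cone contains its own vertex, and the cones over [A] and [B] both contain the cone over the
    finite set [A]|[B]. *)
Lemma finite_parts_filter_proper : ProperFilter finite_parts_filter.
Proof.
apply: filter_from_proper => [|S _]; last by exists S => /=.
apply: filter_from_filter.
  have fin0 : finite_subset set0 by split; [apply: finite_set0|apply: sub0set].
  by exists (exist _ _ fin0).
move=> [A [Afin AT]] [B [Bfin BT]] _ _.
have AB : finite_subset (A `|` B).
  by rewrite /finite_subset finite_setU subUset.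
by exists (exist _ _ AB) => // S /=; rewrite subUset.
Qed.

Lemma finite_parts_filter_mem x : T x -> finite_parts_filter (fun S => sval S x).
Proof.
move=> Tx; have xT : finite_subset [set x].
  by split=> [|_ ->//]; apply: finite_set1.
by exists (exist _ _ xT) => // S; apply.
Qed.

End FiniteParts.

Theorem corollary3p5 (L : language) (T : set (formula L)) :
  theory T -> (satisfiable T <-> finitely_satisfiable T).
Proof.
move=> _; split=> [[M MT] S _ ST|Tfin].
  by exists M => p /ST; apply: MT.
have /(_ _)/cid-/all_tag[M modelM] (S : finite_part T) :
  exists M : structure L, model M (sval S).
  by case: S => S [Sfin ST]; apply: Tfin.
have [U [FU leU]] := ultraFilterLemma (finite_parts_filter_proper T).
exists (ultraproduct FU M) => p Tp; apply: satisfies_ultraproduct.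
(* The finite subsets containing [p] form the cone over [[set p]], which lies in [U], and every
   model chosen for such a subset satisfies [p]. *)
by apply: filterS (leU _ (finite_parts_filter_mem Tp)) => S; apply: modelM.
Qed.
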